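(* Let $1<p\le 2$ and $\sigma_j=j^{-\lambda}$, $j\in\mathbb{N}$, for some $\lambda$ with $0<\lambda<\frac1{p^*}$. Then, for any $\varepsilon\in(0,1)$ and $n\in\mathbb{N}$, there is $m_0\in\mathbb{N}$ with $m_0>n$ such that for all $m\ge m_0$ \[ \mathbb{P}\Big[\mathrm{rad}(\mathcal{E}_{p,\sigma}^m,E_n^{\mathrm{ran}})\ge\frac12\Big]\ge 1-\varepsilon . \]
   Context: $p^*$ is the Hölder conjugate of $p$, i.e. $\frac1p+\frac1{p^*}=1$. The $m$-dimensional $\ell_p$-ellipsoid is $\mathcal{E}_{p,\sigma}^m=\{x\in\mathbb{R}^m:\sum_{i=1}^m |x_i|^p/\sigma_i^p\le 1\}$. For $K\subset\mathbb{R}^m$ and a linear subspace $E\subset\mathbb{R}^m$, $\mathrm{rad}(K,E)=\sup_{x\in K\cap E}\|x\|_2$. $E_n^{\mathrm{ran}}$ is a random linear subspace of $\mathbb{R}^m$ of codimension $n$, distributed according to the rotation invariant probability measure on the Grassmannian of $(m-n)$-dimensional subspaces; equivalently, $E_n^{\mathrm{ran}}=\ker G_{n,m}$ where $G_{n,m}$ is an $n\times m$ matrix with independent standard Gaussian entries. *)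

(* Defs.v *)
From HB Require Import structures.
From mathcomp Require Import all_boot all_order all_algebra.
From mathcomp Require Import all_classical all_reals all_analysis.

Set Implicit Arguments.
Unset Strict Implicit.
Unset Printing Implicit Defensive.

Import Order.TTheory GRing.Theory Num.Theory.
Import numFieldNormedType.Exports.

Local Open Scope classical_set_scope.
Local Open Scope ring_scope.

Section Geometry.
Variables (R : realType) (m : nat).

(* The norm that the library puts on matrices is the sup norm, so the Euclidean
   norm is spelled out. *)
Definition norm2 (x : 'cV[R]_m) : R := Num.sqrt (\sum_(i < m) x i ord0 ^+ 2).

(* Semi-axes are numbered from 1: the coordinate of index i : 'I_m is the
   (i+1)-st one and goes with sigma i.+1; sigma 0 is never used. *)
Definition ellipsoid (p : R) (sigma : nat -> R) : set 'cV[R]_m :=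
  [set x | \sum_(i < m) `|x i ord0| `^ p / sigma i.+1 `^ p <= 1].

(* Extended-real valued, as K `&` E may be unbounded. *)
Definition euclidean_rad (K : set 'cV[R]_m) (E : {vspace 'cV[R]_m}) : \bar R :=
  ereal_sup [set (norm2 x)%:E | x in K `&` [set` E]].

End Geometry.

Definition ker_mx (R : realType) (n m : nat) (A : 'M[R]_(n, m)) :
    {vspace 'cV[R]_m} :=
  lker (linfun (mulmx A : 'cV[R]_m -> 'cV[R]_n)).

Section Probability.
Context (d : measure_display) (T : measurableType d) (R : realType).
Variable P : probability T R.

Definition mutually_independent (I : finType) (X : I -> {RV P >-> R}) : Prop :=
  forall (J : {set I}) (B : I -> set R), (forall i, measurable (B i)) ->
    P (\bigcap_(i in [set` J]) (X i @^-1` B i))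
    = (\prod_(i in J) P (X i @^-1` B i))%E.

(* Compared on measurable sets only: the values of a measure elsewhere are
   meaningless. *)
Definition standard_gaussian (X : {RV P >-> R}) : Prop :=
  forall B : set R, measurable B -> distribution P X B = normal_prob 0 1 B.

Definition gaussian_matrix (n m : nat) (G : 'I_n -> 'I_m -> {RV P >-> R}) :
    Prop :=
  (forall i j, standard_gaussian (G i j)) /\
  mutually_independent (fun k : 'I_n * 'I_m => G k.1 k.2).

(* If G is a Gaussian matrix, its kernel is the random subspace distributed
   according to the rotation invariant probability on the Grassmannian of
   (m - n)-dimensional subspaces (for n < m). *)
Definition E_ran (n m : nat) (G : 'I_n -> 'I_m -> {RV P >-> R}) (t : T) :
    {vspace 'cV[R]_m} :=
  ker_mx (\matrix_(i < n, j < m) G i j t).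

End Probability.

(* Main.v *)
Require Import Defs.
From HB Require Import structures.
From mathcomp Require Import all_boot all_order all_algebra.
From mathcomp Require Import all_classical all_reals all_analysis.
From mathcomp Require Import measurable_realfun ring lra.

(** The plan is to correct the first basis vector e_1, which lies in the
    ellipsoid because sigma_1 = 1, by a vector y supported on the other
    coordinates so that e_1 + y is in the kernel of G.  If the p-ellipsoid
    functional of y is at most 1, then that of (e_1 + y)/2 is at most
    2^-p * 2 <= 1, and its Euclidean norm is at least its first coordinate 1/2
    ([kernel_vector]).

    Such a y exists because m is large while n is fixed.  Among the
    M = m - 1 remaining Gaussian columns, a positive fraction q lies within
    delta of each basis vector e_k of R^n.  The average of the columns near e_k
    is again within delta of e_k, so for delta <= 1/(2n) the matrix B of these
    averages is close enough to the identity for B c = - G e_1 to have a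
    solution of l1-norm at most 2 |G e_1|_1 ([near_identity_solve]).  Spreading
    each c_k evenly over about q M columns gives a y with entries of size
    O(1/M) ([spread_solution]), hence with
      sum_j |y_j|^p / sigma_(j+1)^p = O(M * M^(-p) * M^(lambda p)),
    which tends to 0 exactly because lambda < 1 - 1/p = 1/p^*
    ([spread_weighted_sum_le1]).

    Two facts hold with high probability: the entries of the first column are
    bounded by a constant ([probability_tight]), and each e_k is hit by at least
    qM/2 columns, by Chebyshev's inequality for pairwise independent events
    ([pairwise_independent_count]).

    The event is measurable because the radius of a compact set on a subspace is
    attained: the event says that a continuous coercive function of the vector,
    measurable in the random parameter, reaches 0, which can be tested on
    rational vectors ([measurable_exists_le0], [measurable_rad_ge]). *)

Set Implicit Arguments.
Unset Strict Implicit.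
Unset Printing Implicit Defensive.

Import Order.TTheory GRing.Theory Num.Theory.
Import numFieldNormedType.Exports.

Local Open Scope classical_set_scope.
Local Open Scope ring_scope.

(** * Measurability of the radius event *)

Lemma continuous_powR_norm (R : realType) (p : R) :
  0 < p -> continuous (fun x : R => `|x| `^ p).
Proof.
move=> p0 x; have [->|x0] := eqVneq x 0.
  apply/cvgrPdist_lt => e e0; near=> y.
  rewrite normr0 powR0 ?gt_eqF// sub0r normrN ger0_norm ?powR_ge0//.
  have -> : e = (e `^ p^-1) `^ p.
    by rewrite -powRrM mulVf ?gt_eqF// powRr1// ltW.
  rewrite gt0_ltr_powR// ?nnegrE ?powR_ge0//.
  near: y; apply/nbhs_ballP; exists (e `^ p^-1); first exact: powR_gt0.
  by move=> y; rewrite /ball/= sub0r normrN.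
apply: (@continuous_comp _ _ _ (@Num.norm R R) (fun y => y `^ p)).
  exact: norm_continuous.
apply: differentiable_continuous; apply/derivable1_diffP.
by apply: derivable_powR; rewrite in_itv/= andbT normr_gt0.
Unshelve. all: by end_near. Qed.

(** Values of [F] below 1 are only taken on [K], so the infimum is the minimum
    over a compact set. *)
Lemma compact_le0_attained (R : realType) (X : topologicalType) (K : set X)
    (F : X -> R) :
  compact K -> continuous F -> (forall x, F x <= 1 -> K x) ->
  (forall e : R, 0 < e -> exists x, F x < e) -> exists x, F x <= 0.
Proof.
move=> cK cF FK small.
have K0 : K !=set0.
  by have [x Fx] := small 1 ltr01; exists x; apply: FK; exact: ltW.
have [c cK' minc] : exists2 c, c \in K & forall x, x \in K -> F c <= F x.
  by apply: compact_EVT_min => //; exact: continuous_subspaceT.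
exists c; apply/ler_addgt0Pl => e e0; rewrite addr0.
have [x] := small (Num.min 1 e) (ltac:(by rewrite lt_min ltr01)).
rewrite lt_min => /andP[/ltW Fx1 /ltW Fxe].
by apply: le_trans Fxe; apply: minc; rewrite inE; exact: FK.
Qed.

Lemma ratr_row_lt (R : realType) (m : nat) (F : 'rV[R]_m -> R) (e : R) v :
  continuous F -> F v < e -> exists q : 'rV[rat]_m, F (map_mx ratr q) < e.
Proof.
move=> cF Fve.
have /cvgrPdist_lt/(_ (e - F v)) := cF v; rewrite subr_gt0 => /(_ Fve).
move=> /nbhs_ballP[r /= r0 rF].
have near_rat i : exists q : rat, `|v 0 i - ratr q| < r.
  have /rat_in_itvoo[q] : v 0 i - r < v 0 i + r by rewrite ltrD2l gtrN.
  by rewrite in_itv/= -ltr_distl distrC => ?; exists q.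
have [q qv] := choice near_rat.
exists (\row_i q i).
have /rF : ball v r (map_mx (@ratr R) (\row_i q i)).
  by split => // i j; rewrite !mxE ord1; exact: qv.
by rewrite /= distrC => /(le_lt_trans (ler_norm _)); rewrite ltrD2r.
Qed.

(** An uncountable union over [v] becomes countable: since the minimum of [F t]
    is attained, it is at most 0 iff [F t] is below every [1/(k+1)] somewhere,
    and by continuity this happens at a rational vector. *)
Lemma measurable_exists_le0 (d : measure_display) (T : measurableType d)
    (R : realType) (m : nat) (K : set 'rV[R]_m) (F : T -> 'rV[R]_m -> R) :
  compact K -> (forall t v, F t v <= 1 -> K v) ->
  (forall t, continuous (F t)) -> (forall v, measurable_fun setT (F ^~ v)) ->
  measurable [set t | exists v, F t v <= 0].
Proof.
move=> cK FK cF mF.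
rewrite [X in measurable X](_ : _ = \bigcap_(k : nat) \bigcup_(q : 'rV[rat]_m)
    (F ^~ (map_mx ratr q) @^-1` `]-oo, k.+1%:R^-1[)).
  apply: bigcapT_measurable => k.
  apply: countable_bigcupT_measurable => [|q]; first exact: countableP.
  by rewrite -[X in measurable X]setTI; exact: mF.
apply/seteqP; split => [t [v Fv] k _|t small].
  have [q Fq] : exists q : 'rV[rat]_m, F t (map_mx ratr q) < k.+1%:R^-1.
    by apply: (ratr_row_lt (v := v)) => //; rewrite (le_lt_trans Fv).
  by exists q; rewrite //= in_itv.
apply: (compact_le0_attained cK (cF t) (FK t)) => e e0.
have /ltr_add_invr[k] := e0; rewrite add0r => ke.
have [q _] := small k I; rewrite /= in_itv/= => Fq.
by exists (map_mx ratr q); exact: lt_trans ke.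
Qed.

(** Membership of [v] in the ellipsoid and in the kernel of [A], turned into one
    nonnegative continuous function to be compared with 0. *)
Definition constraint_defect (R : realType) (n m : nat) (p : R)
    (sigma : nat -> R) (A : 'I_n -> 'I_m -> R) (v : 'rV[R]_m) : R :=
  Num.max (\sum_(i < m) `|v 0 i| `^ p / sigma i.+1 `^ p - 1) 0
  + \sum_(i < n) `|\sum_(j < m) A i j * v 0 j|.

(** Zero exactly at the points of the section of norm at least [r]; continuity
    and coercivity in [v] make it a witness function for the radius event. *)
Definition defect (R : realType) (n m : nat) (p r : R) (sigma : nat -> R)
    (A : 'I_n -> 'I_m -> R) (v : 'rV[R]_m) : R :=
  constraint_defect p sigma A v + Num.max (r - norm2 v^T) 0.

Section Defect.
Context (R : realType) (n m : nat) (p : R) (sigma : nat -> R).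
Hypotheses (p_gt0 : 0 < p) (sigma_gt0 : forall i, 0 < sigma i.+1).
Implicit Types (A : 'I_n -> 'I_m -> R) (v : 'rV[R]_m) (r : R).

Let max0_ge0 (x : R) : 0 <= Num.max x 0. Proof. by rewrite le_max lexx orbT. Qed.

Lemma constraint_defect_ge0 A v : 0 <= constraint_defect p sigma A v.
Proof. by rewrite addr_ge0// sumr_ge0. Qed.

Lemma continuous_defect r A : continuous (defect p r sigma A).
Proof.
have coord i : continuous (fun v : 'rV[R]_m => v 0 i) by exact: coord_continuous.
have cst_cont (c : R) : continuous (fun _ : 'rV[R]_m => c) by exact: cst_continuous.
have sum_cont k (f : 'I_k -> 'rV[R]_m -> R) : (forall i, continuous (f i)) ->
    continuous (fun v => \sum_(i < k) f i v).
  move=> cf; apply: continuous_big => [|i _]; last exact: cf.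
  exact: add_continuous.
have add_cont (f g : 'rV[R]_m -> R) :
    continuous f -> continuous g -> continuous (f \+ g).
  by move=> cf cg v; exact: continuousD (cf v) (cg v).
have mul_cont (f g : 'rV[R]_m -> R) :
    continuous f -> continuous g -> continuous (f \* g).
  by move=> cf cg v; exact: continuousM (cf v) (cg v).
have max_cont (f : 'rV[R]_m -> R) :
    continuous f -> continuous (f \max cst 0).
  by move=> cf v; exact: continuous_max (cf v) (cst_cont 0 v).
have comp_cont (f : 'rV[R]_m -> R) (g : R -> R) :
    continuous f -> continuous g -> continuous (g \o f).
  by move=> cf cg v; exact: continuous_comp (cf v) (cg _).
have norm_cont : continuous (fun v : 'rV[R]_m => norm2 v^T).
  apply: (comp_cont _ _ _ (@sqrt_continuous R)).
  apply: (sum_cont _ (fun i v => v^T i ord0 ^+ 2)) => i.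
  apply: (comp_cont (fun v => v^T i ord0) _ _ (@exprn_continuous R 2)).
  by under eq_fun do rewrite mxE; exact: coord.
apply: (add_cont _ _); first apply: (add_cont _ _).
- apply: max_cont; apply: (add_cont _ (cst (-1))); last exact: cst_cont.
  apply: sum_cont => i; apply: (mul_cont _ (cst _)); last exact: cst_cont.
  exact: (comp_cont _ _ (coord i) (continuous_powR_norm p_gt0)).
- apply: (sum_cont _ _) => i; apply: (comp_cont _ _ _ (@norm_continuous _ R)).
  apply: (sum_cont _ (fun j v => A i j * v 0 j)) => j.
  by apply: (mul_cont (cst _)); [exact: cst_cont|exact: coord].
- apply: max_cont; apply: (add_cont (cst r)); first exact: cst_cont.
  exact: (comp_cont _ _ norm_cont (@opp_continuous R)).
Qed.

(* A defect at most 1 bounds each weighted coordinate power by 2, whence the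
   factor [2 `^ p^-1]. *)
Let bound (i : 'I_m) : R := 2 `^ p^-1 * sigma i.+1.

Let box : set 'rV[R]_m := [set v | forall i, `[- bound i, bound i]%classic (v 0 i)].

Let compact_box : compact box.
Proof.
apply: (@rV_compact R m (fun i => `[- bound i, bound i]%classic)) => i.
exact: segment_compact.
Qed.

Let defect_le1_box r A v : defect p r sigma A v <= 1 -> box v.
Proof.
move=> le1 i.
have : Num.max (\sum_(j < m) `|v 0 j| `^ p / sigma j.+1 `^ p - 1) 0 <= 1.
  apply: le_trans le1; rewrite /defect /constraint_defect -addrA lerDl.
  by rewrite addr_ge0 ?sumr_ge0.
rewrite ge_max lerBlDr => /andP[h1 _].
have term_ge0 j : 0 <= `|v 0 j| `^ p / sigma j.+1 `^ p.
  by rewrite divr_ge0// powR_ge0.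
have : `|v 0 i| `^ p / sigma i.+1 `^ p <= 1 + 1.
  by apply: le_trans h1; rewrite (bigD1 i)//= lerDl sumr_ge0.
rewrite ler_pdivrMr ?powR_gt0// /= in_itv/= -ler_norml => vi.
rewrite leNgt; apply/negP => lt_v.
suff : (bound i) `^ p < `|v 0 i| `^ p.
  rewrite powRM ?powR_ge0 ?ltW// -powRrM mulVf ?gt_eqF// powRr1//.
  by rewrite ltNge vi.
by rewrite gt0_ltr_powR// ?nnegrE ?mulr_ge0 ?powR_ge0 ?ltW.
Qed.

Lemma constraint_defect_eq0 A v : constraint_defect p sigma A v = 0 <->
  ellipsoid p sigma v^T /\ (\matrix_(i, j) A i j) *m v^T = 0.
Proof.
have sumT : \sum_(i < m) `|v^T i ord0| `^ p / sigma i.+1 `^ p =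
            \sum_(i < m) `|v 0 i| `^ p / sigma i.+1 `^ p.
  by apply: eq_bigr => i _; rewrite mxE.
have mulT i : ((\matrix_(i, j) A i j) *m v^T) i 0 = \sum_(j < m) A i j * v 0 j.
  by rewrite mxE; apply: eq_bigr => j _; rewrite !mxE.
split=> [/eqP|[vK Av]].
  rewrite paddr_eq0 ?sumr_ge0// => /andP[z1 z2]; split.
    by rewrite /ellipsoid/= sumT -subr_le0; apply/max_idPr/eqP.
  apply/colP => i; rewrite mulT mxE; apply/eqP; rewrite -normr_eq0.
  by move: z2; rewrite psumr_eq0// => /allP/(_ i (mem_index_enum _)).
rewrite /constraint_defect max_r ?subr_le0 -?sumT// add0r.
by rewrite big1// => i _; rewrite -mulT Av mxE normr0.
Qed.

(** The supremum defining the radius is attained, by compactness, so that the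
    non-strict inequality is about a single vector. *)
Lemma le_radP r A : (r%:E <= euclidean_rad (ellipsoid p sigma)
    (ker_mx (\matrix_(i, j) A i j)))%E <-> exists v, defect p r sigma A v <= 0.
Proof.
split=> [rad_ge|[v]]; last first.
  move=> le0; have : defect p r sigma A v == 0.
    by rewrite eq_le le0 addr_ge0// constraint_defect_ge0.
  rewrite paddr_eq0 ?constraint_defect_ge0//.
  move=> /andP[/eqP/constraint_defect_eq0[vK Av] /eqP vr].
  apply: (le_trans (_ : _ <= (norm2 v^T)%:E)%E).
    by rewrite lee_fin -subr_le0; apply/max_idPr.
  apply: ereal_sup_ubound; exists v^T => //; split => //=.
  by rewrite memv_ker lfunE/= Av.
apply: (compact_le0_attained (F := defect p r sigma A) compact_box) => [|v|e e0].
- exact: continuous_defect.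
- exact: defect_le1_box.
have /ereal_sup_gt[_ [x [xK xE] <-]] :
    ((r - e)%:E < euclidean_rad (ellipsoid p sigma) (ker_mx (\matrix_(i, j) A i j)))%E.
  by apply: lt_le_trans rad_ge; rewrite lte_fin gtrBl.
rewrite lte_fin ltrBlDr addrC -ltrBlDr => xr; exists x^T.
rewrite /defect (constraint_defect_eq0 _ _).2 ?trmxK; last first.
  by move: xE; rewrite /= memv_ker lfunE => /eqP.
by rewrite add0r gt_max xr.
Qed.

Lemma measurable_rad_ge (d : measure_display) (T : measurableType d)
    (P : probability T R) (r : R) (G : 'I_n -> 'I_m -> {RV P >-> R}) :
  measurable
    [set t | (r%:E <= euclidean_rad (ellipsoid p sigma) (E_ran G t))%E].
Proof.
rewrite (_ : mkset _ =
    [set t | exists v, defect p r sigma (fun i j => G i j t) v <= 0]); last first.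
  by apply/seteqP; split => t /=; rewrite /E_ran => /le_radP.
apply: (measurable_exists_le0 compact_box).
- by move=> t v /defect_le1_box.
- by move=> t; exact: continuous_defect.
move=> v; rewrite /defect /constraint_defect.
apply: measurable_funD => //; apply: measurable_funD => //.
apply: measurable_sum => i; apply: measurableT_comp => //.
by apply: measurable_sum => j; apply: measurable_funM.
Qed.

End Defect.

(** * A short kernel vector from columns near the basis *)

(** For every [c], the l1-norm of [c - B c] is at most [n delta] times that of
    [c], hence at most half of it; so the l1-norm of [c] is at most twice that of
    [B c], which gives injectivity and the bound at once. *)
Lemma near_identity_solve (R : realFieldType) (n : nat) (delta : R)
    (B : 'M[R]_n) (b : 'cV[R]_n) :
  (forall i k, `|B i k - (i == k)%:R| <= delta) -> n%:R * delta <= 2^-1 ->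
  exists2 c : 'cV[R]_n, B *m c = b & \sum_k `|c k 0| <= 2 * \sum_k `|b k 0|.
Proof.
move=> Bdelta ndelta.
have lower (c : 'cV[R]_n) : \sum_k `|c k 0| <= 2 * \sum_k `|(B *m c) k 0|.
  set S := \sum_k `|c k 0|.
  have S0 : 0 <= S by exact: sumr_ge0.
  have err i : `|c i 0 - (B *m c) i 0| <= delta * S.
    have -> : c i 0 - (B *m c) i 0 = - \sum_k (B i k - (i == k)%:R) * c k 0.
      rewrite mxE -opprB; congr (- _).
      under [in RHS]eq_bigr do rewrite mulrBl.
      rewrite sumrB; congr (_ - _).
      rewrite (bigD1 i)//= eqxx mul1r big1 ?addr0// => k ki.
      by rewrite eq_sym (negbTE ki) mul0r.
    rewrite normrN (le_trans (ler_norm_sum _ _ _))// mulr_sumr.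
    by apply: ler_sum => k _; rewrite normrM ler_wpM2r.
  have : S <= \sum_k `|(B *m c) k 0| + n%:R * (delta * S).
    rewrite -[X in X%:R * _]card_ord mulr_natl -sumr_const -big_split/=.
    apply: ler_sum => i _.
    have {1}-> : c i 0 = (B *m c) i 0 + (c i 0 - (B *m c) i 0).
      by rewrite addrC subrK.
    by rewrite (le_trans (ler_normD _ _))// lerD2l err.
  have : n%:R * (delta * S) <= 2^-1 * S by rewrite mulrA ler_wpM2r.
  by lra.
have unitB : B \in unitmx.
  rewrite -unitmx_tr -row_free_unit; apply: inj_row_free => v vB.
  have := lower v^T; rewrite -[B *m _]trmxK trmx_mul trmxK vB trmx0.
  rewrite [X in _ <= 2 * X]big1 ?mulr0; last by move=> k _; rewrite mxE normr0.
  move=> v0; have : \sum_k `|v^T k 0| == 0 by rewrite eq_le v0 sumr_ge0.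
  rewrite psumr_eq0// => /allP z; apply/rowP => k.
  have /eqP := z k (mem_index_enum _).
  by rewrite !mxE => /normr0_eq0.
exists (invmx B *m b); first by rewrite mulmxA mulmxV// mul1mx.
by rewrite (le_trans (lower _))// mulmxA mulmxV// mul1mx.
Qed.

(** Closeness to the basis vector [e_k] is measured in the sup norm since this makes
    it a product event for a column with independent entries. *)
Definition hits (R : realFieldType) (n : nat) (delta : R) (g : 'I_n -> R)
    (k : 'I_n) : bool :=
  [forall i, `|g i - (i == k)%:R| <= delta].

(** Averages of columns close to [e_k] are close to [e_k], so [b] is a combination
    of the [n] averages; a coefficient is shared by at least [s] columns, whence
    the factor [1/s]. *)
Lemma spread_solution (R : realFieldType) (n M : nat) (delta C s : R)
    (A : 'I_n -> 'I_M -> R) (b : 'I_n -> R) :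
  n%:R * delta <= 2^-1 -> 0 < s -> (forall i, `|b i| <= C) ->
  (forall k, s <= #|[pred j | hits delta (A ^~ j) k]|%:R) ->
  exists2 y : 'I_M -> R, forall i, \sum_j A i j * y j = b i
    & forall j, `|y j| <= 2 * (n%:R * C) / s.
Proof.
move=> ndelta s0 bC many.
pose N k := [pred j | hits delta (A ^~ j) k].
have N0 k : 0 < #|N k|%:R :> R by exact: lt_le_trans (many k).
pose W : 'M[R]_(M, n) := \matrix_(j, k) ((j \in N k)%:R / #|N k|%:R).
pose A' : 'M[R]_(n, M) := \matrix_(i, j) A i j.
have AWE i k : (A' *m W) i k = (\sum_(j in N k) A i j) / #|N k|%:R.
  rewrite mxE mulr_suml [RHS]big_mkcond/=; apply: eq_bigr => j _; rewrite !mxE.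
  by case: ifP => _; rewrite ?mul1r// mul0r mulr0.
have AWdelta i k : `|(A' *m W) i k - (i == k)%:R| <= delta.
  have -> : (A' *m W) i k - (i == k)%:R =
      (\sum_(j in N k) (A i j - (i == k)%:R)) / #|N k|%:R.
    rewrite AWE sumrB sumr_const -[_ *+ #|_|]mulr_natr mulrBl mulfK//.
    by rewrite gt_eqF ?N0.
  rewrite normrM normfV (ger0_norm (ltW (N0 k))) ler_pdivrMr//.
  rewrite (le_trans (ler_norm_sum _ _ _))// mulr_natr -sumr_const.
  by apply: ler_sum => j; rewrite inE => /forallP.
have [c AWc cb] := near_identity_solve (\col_i b i) AWdelta ndelta.
exists (fun j => (W *m c) j 0) => [i|j].
  transitivity ((A' *m W *m c) i 0); last by rewrite AWc mxE.
  by rewrite -mulmxA [RHS]mxE; apply: eq_bigr => j _; rewrite !mxE.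
rewrite mxE (le_trans (ler_norm_sum _ _ _))//.
apply: (@le_trans _ _ ((\sum_k `|c k 0|) / s)).
  rewrite mulr_suml; apply: ler_sum => k _; rewrite mxE normrM mulrC.
  rewrite ler_wpM2l// normrM normfV !normr_nat.
  rewrite (@le_trans _ _ (#|N k|%:R^-1))//.
    by rewrite ler_piMl ?invr_ge0 ?ler0n// lern1 leq_b1.
  by rewrite lef_pV2// ?posrE//; exact: many.
rewrite ler_pM2r ?invr_gt0// (le_trans cb)// ler_wpM2l//.
rewrite -[X in X%:R * C]card_ord mulr_natl -sumr_const.
by apply: ler_sum => k _; rewrite mxE.
Qed.

(** The witness is [(e_1 + y)/2]; halving absorbs the sum of the two ellipsoid
    functionals, each at most 1, since [2^-p <= 1/2]. *)
Lemma kernel_vector (R : realType) (n M : nat) (p : R) (sigma : nat -> R)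
    (A : 'I_n -> 'I_M.+1 -> R) (y : 'I_M -> R) :
  1 <= p -> sigma 1%N = 1 ->
  (forall i, \sum_j A i (lift ord0 j) * y j = - A i ord0) ->
  \sum_j `|y j| `^ p / sigma (lift ord0 j).+1 `^ p <= 1 ->
  (2^-1%:E <= euclidean_rad (ellipsoid p sigma) (ker_mx (\matrix_(i, j) A i j)))%E.
Proof.
move=> p1 sigma1 Ay yK.
pose z (j : 'I_M.+1) : R := if unlift ord0 j is Some i then y i else 1.
have z0 : z ord0 = 1 by rewrite /z unlift_none.
have zS j : z (lift ord0 j) = y j by rewrite /z liftK.
pose x : 'cV[R]_M.+1 := \col_j (2^-1 * z j).
apply: (@le_trans _ _ (norm2 x)%:E); last first.
  apply: ereal_sup_ubound; exists x => //; split => /=.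
    rewrite /ellipsoid/=.
    have -> : \sum_(i < M.+1) `|x i ord0| `^ p / sigma i.+1 `^ p =
        2^-1 `^ p * \sum_(i < M.+1) `|z i| `^ p / sigma i.+1 `^ p.
      rewrite mulr_sumr; apply: eq_bigr => i _.
      by rewrite mxE normrM (@ger0_norm _ 2^-1)// powRM// mulrA.
    apply: (@le_trans _ _ (2^-1 * 2)); last by rewrite mulVf.
    apply: ler_pM; rewrite ?powR_ge0//.
    - by apply: sumr_ge0 => i _; rewrite divr_ge0// powR_ge0.
    - by apply: ge1r_powR => //; lra.
    rewrite big_ord_recl z0 normr1 sigma1 powR1 divr1.
    by under eq_bigr do rewrite zS; rewrite -[leRHS]/(1 + 1) lerD2l.
  rewrite memv_ker lfunE/=; apply/eqP/colP => i.
  rewrite mxE big_ord_recl !mxE z0 mulr1.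
  under eq_bigr do rewrite !mxE zS mulrCA.
  by rewrite -mulr_sumr Ay mulrN mulrC subrr.
rewrite lee_fin /norm2 -(@ger0_norm _ 2^-1)// -sqrtr_sqr ler_wsqrtr//.
rewrite big_ord_recl mxE z0 mulr1 lerDl.
by apply: sumr_ge0 => i _; exact: sqr_ge0.
Qed.

(** The sum is at most [M (D/M)^p (2M)^(lambda p)], a constant times [M^(-a)] with
    [a = p - lambda p - 1 > 0]. *)
Lemma spread_weighted_sum_le1 (R : realType) (p lambda D : R) :
  0 <= p -> 0 <= lambda -> lambda * p + 1 < p -> 0 <= D ->
  exists M0 : nat, forall M, (M0 <= M)%N -> (0 < M)%N -> forall y : 'I_M -> R,
    (forall j, `|y j| <= D / M%:R) ->
    \sum_j `|y j| `^ p / ((lift ord0 j).+1%:R `^ (- lambda)) `^ p <= 1.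
Proof.
move=> p0 l0 lp D0.
pose a := p - lambda * p - 1; have a0 : 0 < a by rewrite /a; lra.
pose K := D `^ p * 2 `^ (lambda * p).
have K0 : 0 <= K by rewrite mulr_ge0// powR_ge0.
exists (Num.bound (K `^ a^-1)) => M M0M M_gt0 y yD.
have MR : 0 < M%:R :> R by rewrite ltr0n.
have KM : K <= M%:R `^ a.
  rewrite [leLHS](_ : K = (K `^ a^-1) `^ a); last first.
    by rewrite -powRrM mulVf ?gt_eqF// powRr1.
  apply: ge0_ler_powR; rewrite ?nnegrE ?powR_ge0 ?ler0n ?(ltW a0)//.
  have /ltW/le_trans := archi_boundP (powR_ge0 K a^-1); apply.
  by rewrite ler_nat.
apply: (@le_trans _ _ (\sum_(j < M) (D / M%:R) `^ p * (2 * M%:R) `^ (lambda * p))).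
  apply: ler_sum => j _; apply: ler_pM; rewrite ?invr_ge0 ?powR_ge0//.
    by rewrite ge0_ler_powR ?nnegrE ?divr_ge0 ?ler0n.
  rewrite -powRN -powRrM mulrN mulNr opprK ge0_ler_powR ?nnegrE ?mulr_ge0 ?ler0n//.
  rewrite -natrM ler_nat /= /bump/= mul2n -addnn.
  by rewrite add1n -addn1 leq_add.
have -> : (D / M%:R) `^ p = D `^ p * M%:R `^ (- p).
  by rewrite powRM ?invr_ge0 ?ler0n// -powR_inv1 ?ler0n// -powRrM mulN1r.
rewrite sumr_const card_ord -[_ *+ M]mulr_natl powRM ?ler0n//.
have -> : M%:R * (D `^ p * M%:R `^ (- p) * (2 `^ (lambda * p) * M%:R `^ (lambda * p)))
    = K * (M%:R `^ 1 * M%:R `^ (- p) * M%:R `^ (lambda * p)) :> R.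
  by rewrite powRr1 ?ler0n// /K; ring.
rewrite -!powRD ?(gt_eqF MR) ?implybT//.
have -> : 1 - p + lambda * p = - a by rewrite /a; ring.
by rewrite powRN ler_pdivrMr ?powR_gt0// mul1r.
Qed.

(** * Counting pairwise independent events, tightness *)

Lemma indic_covariance (d : measure_display) (T : measurableType d)
    (R : realType) (P : probability T R) (A B : set T) :
  measurable A -> measurable B ->
  covariance P \1_A \1_B = (P (A `&` B) - P A * P B)%E.
Proof.
move=> mA mB.
have int1 (C : set T) : measurable C -> (\1_C : T -> R) \in Lfun P 1.
  by move=> mC; apply/Lfun1_integrable; exact: integrable_indic.
have -> : covariance P \1_A \1_B =
    ('E_P[\1_A * \1_B] - 'E_P[\1_A] * 'E_P[\1_B])%E.
  apply: covarianceE; rewrite ?int1//.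
  by have := int1 _ (measurableI _ _ mA mB); rewrite indicI.
have -> : (\1_A * \1_B : T -> R) = \1_(A `&` B) by rewrite indicI.
by rewrite !expectation_indic//; exact: measurableI.
Qed.

(** Chebyshev's inequality: pairwise independence makes the centred indicators
    orthogonal, so the variance of the count is at most [q #|I|], while an
    undershoot by half of the mean costs [(q #|I| / 2)^2]. *)
Lemma pairwise_independent_count (d : measure_display) (T : measurableType d)
    (R : realType) (P : probability T R) (I : finType) (A : I -> set T) (q : R) :
  0 < q -> (forall i, measurable (A i)) -> (forall i, P (A i) = q%:E) ->
  (forall i j, i != j -> P (A i `&` A j) = (q * q)%:E) ->
  measurable [set t | #|[pred i | t \in A i]|%:R < q * #|I|%:R / 2] /\
  (P [set t | (#|[pred i | t \in A i]|%:R < q * #|I|%:R / 2)%R] <=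
    (4 / (q * #|I|%:R))%:E)%E.
Proof.
move=> q0 mA PA PAA.
set N := #|I|%:R; set bad := mkset _.
have [I0|I0] := posnP #|I|.
  have -> : bad = set0.
    by apply/seteqP; split => // t; rewrite /bad /N /= I0 mulr0 mul0r ltNge ler0n.
  by split => //; rewrite measure0 lee_fin divr_ge0// mulr_ge0 ?ler0n// ltW.
have N0 : 0 < N by rewrite ltr0n.
(* The sum of the centred indicators [Y i] is the count minus its mean. *)
pose Y i : T -> R := \1_(A i) \- cst q.
have mY i : measurable_fun setT (Y i) by exact: measurable_funB.
have YE t : \sum_i Y i t = #|[pred i | t \in A i]|%:R - q * N.
  rewrite sumrB sumr_const mulr_natr; congr (_ - _).
  rewrite -sum1_card natr_sum [RHS]big_mkcond/=; apply: eq_bigr => i _.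
  by rewrite indicE inE; case: ifP.
have mS : measurable_fun setT (fun t => \sum_i Y i t) by exact: measurable_sum.
have mbad : measurable bad.
  rewrite (_ : bad = (fun t => \sum_i Y i t) @^-1` `]-oo, - (q * N / 2)[); last first.
    apply/seteqP; split => t; rewrite /bad /= in_itv/= YE; lra.
  by rewrite -[X in measurable X]setTI; exact: mS.
split => //.
have iYY i j : P.-integrable setT (EFin \o (Y i \* Y j)).
  apply: measurable_bounded_integrable => //.
  - by rewrite (le_lt_trans (probability_le1 P _)) ?ltry.
  - exact: measurable_funM.
  exists ((1 + q) * (1 + q)); split; first exact: num_real.
  move=> x xq t _ /=; apply/ltW/(le_lt_trans _ xq).
  have Yb k : `|Y k t| <= 1 + q.
    rewrite /Y/= (le_trans (ler_normB _ _))// (gtr0_norm q0) lerD2r indicE.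
    by rewrite normr_nat lern1 leq_b1.
  by rewrite normrM ler_pM.
have EYY i j : (\int[P]_t (Y i t * Y j t)%:E <= (if i == j then q else 0)%:E)%E.
  have -> : (\int[P]_t (Y i t * Y j t)%:E)%E = covariance P \1_(A i) \1_(A j).
    by rewrite unlock !expectation_indic// !PA/= unlock.
  rewrite indic_covariance// !PA; case: eqP => [->|/eqP ij].
    by rewrite setIid PA -EFinM -EFinB lee_fin gerBl mulr_ge0// ltW.
  by rewrite PAA// -EFinM -EFinB subrr.
have ES : (\int[P]_t ((\sum_i Y i t) ^+ 2)%:E <= (q * N)%:E)%E.
  have -> : (\int[P]_t ((\sum_i Y i t) ^+ 2)%:E =
      \sum_i \sum_j \int[P]_t (Y i t * Y j t)%:E)%E.
    rewrite pair_big/= -integral_sum//; last by move=> n; exact: iYY.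
    apply: eq_integral => t _; rewrite sumEFin; congr EFin.
    by rewrite expr2 big_distrlr/= pair_big.
  apply: (@le_trans _ _ (\sum_i \sum_j (if i == j then q else 0)%:E)%E).
    by apply: lee_sum => i _; apply: lee_sum => j _.
  rewrite (eq_bigr (fun=> q%:E)); last first.
    move=> i _; rewrite sumEFin -big_mkcond/=.
    by rewrite (eq_bigl (pred1 i)) ?big_pred1_eq// => j; rewrite eq_sym.
  by rewrite sumEFin sumr_const mulr_natr.
have c0 : 0 < (q * N / 2) ^+ 2 by rewrite exprn_gt0// divr_gt0 ?mulr_gt0.
have markov : (((q * N / 2) ^+ 2)%:E * P bad <= (q * N)%:E)%E.
  apply: le_trans ES; rewrite -[bad]setIT -integral_indic//.
  rewrite -ge0_integralZl_EFin//; last 2 first.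
  - exact/measurable_EFinP/measurable_indic.
  - exact: ltW.
  apply: ge0_le_integral => //.
  - by move=> t _; rewrite -EFinM lee_fin mulr_ge0 ?sqr_ge0 ?indicE ?ler0n.
  - by apply/measurable_EFinP/measurable_funM => //; exact: measurable_indic.
  - by apply/measurable_EFinP/measurable_funX.
  move=> t _; rewrite -EFinM lee_fin indicE.
  have [tbad|_] := boolP (t \in bad); last by rewrite mulr0 sqr_ge0.
  have : \sum_i Y i t < - (q * N / 2).
    by move: tbad; rewrite inE /bad/= YE; lra.
  have := mulr_gt0 q0 N0; set S := \sum_i _ => qN0 Sbad.
  by rewrite mulr1 -(sqrrN S) ler_pXn2r// ?nnegrE; lra.
rewrite -lee_pdivlMl// in markov.
apply: (le_trans markov); rewrite -EFinM lee_fin le_eqVlt; apply/orP; left.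
by apply/eqP; field; rewrite !gt_eqF.
Qed.

(** The continuous positive density has a positive minimum on the interval. *)
Lemma normal_prob_itv_gt0 (R : realType) (a b : R) :
  a < b -> (0 < normal_prob 0 1 `[a, b])%E.
Proof.
move=> ab.
have [c cab cmin] : exists2 c, c \in `[a, b] &
    forall t, t \in `[a, b] -> normal_pdf 0 1 c <= normal_pdf 0 1 t :> R.
  apply: EVT_min; first exact: ltW.
  by apply: continuous_subspaceT; apply: continuous_normal_pdf; exact: oner_neq0.
have c0 : 0 < normal_pdf 0 1 c.
  by rewrite normal_pdfE ?oner_neq0// mulr_gt0 ?normal_peak_gt0 ?oner_neq0 ?expR_gt0.
apply: (@lt_le_trans _ _ (\int[lebesgue_measure]_(x in `[a, b]) (normal_pdf 0 1 c)%:E)%E).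
  rewrite integral_cst//= lebesgue_measure_itv/= lte_fin ab -EFinD -EFinM lte_fin.
  by rewrite mulr_gt0// subr_gt0.
apply: ge0_le_integral => //=.
- by move=> x _; rewrite lee_fin ltW.
- apply/measurable_EFinP; apply: measurable_funTS; exact: measurable_normal_pdf.
Qed.

(** The events [k < |x|] decrease to the empty set. *)
Lemma probability_tight (R : realType) (mu : probability (measurableTypeR R) R) (e : R) :
  0 < e -> exists2 C : R, 0 <= C & (mu [set x | (C < `|x|)%R] <= e%:E)%E.
Proof.
move=> e0.
pose F (k : nat) : set R := [set x : R | k%:R < `|x|].
have mF k : measurable (F k).
  rewrite [X in measurable X](_ : _ = (@Num.norm R R) @^-1` `]k%:R, +oo[).
    by rewrite -[X in measurable X]setTI; exact: normr_measurable.
  by apply/seteqP; split => x; rewrite /F/= in_itv/= andbT.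
have F0 : \bigcap_k F k = set0.
  apply/seteqP; split => // x Fx; have := Fx (Num.bound `|x|) I.
  by rewrite /F/= ltNge ltW// archi_boundP.
have : mu \o F @ \oo --> 0%E.
  rewrite -(measure0 mu) -F0; apply: nonincreasing_cvg_mu => //.
  - exact: le_lt_trans (probability_le1 mu (mF 0%N)) (ltry _).
  - exact: bigcapT_measurable.
  - move=> k l kl; apply/subsetPset => x; rewrite /F/=.
    by apply: le_lt_trans; rewrite ler_nat.
move=> /fine_cvgP[fin /cvgrPdist_le/(_ _ e0) small].
near \oo => k.
exists k%:R; first exact: ler0n.
have Fin : mu (F k) \is a fin_num by near: k.
rewrite -/(F k) -(fineK Fin) lee_fin.
have : `|0 - fine (mu (F k))| <= e by near: k.
by rewrite sub0r normrN ger0_norm// fine_ge0.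
Unshelve. all: by end_near. Qed.

Lemma probability_bigsetU_le (d : measure_display) (T : measurableType d)
    (R : realType) (P : probability T R) (I : finType) (F : I -> set T) :
  (forall i, measurable (F i)) ->
  (P (\big[setU/set0]_i F i) <= \sum_i P (F i))%E.
Proof.
move=> mF; suff: measurable (\big[setU/set0]_i F i) /\
  (P (\big[setU/set0]_i F i) <= \sum_i P (F i))%E by case.
elim/big_ind2 : _ => [|B x C y [mB Bx] [mC Cy]|i _]; last by split.
  by rewrite measure0; split.
split; first exact: measurableU.
by rewrite (le_trans (measureU2 _ _ _))// leeD.
Qed.

(** * Gaussian columns near the basis *)

Section GaussianColumns.
Context (R : realType) (delta : R).
Hypothesis delta_gt0 : 0 < delta.

Let box (b : bool) : set R := `[b%:R - delta, b%:R + delta]%classic.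

Let box_prob (b : bool) : R := fine (normal_prob 0 1 (box b)).

Let box_probE b : normal_prob 0 1 (box b) = (box_prob b)%:E.
Proof. by rewrite fineK// fin_num_measure//; exact: measurable_itv. Qed.

(** The probability that a standard Gaussian column is near a given [e_k]: one
    coordinate must be near 1 and the [n - 1] others near 0, whatever [k] is. *)
Definition hit_prob (n : nat) : R := box_prob true * box_prob false ^+ n.-1.

Lemma hit_prob_gt0 n : 0 < hit_prob n.
Proof.
have box_gt0 b : 0 < box_prob b.
  rewrite -lte_fin -box_probE; apply: normal_prob_itv_gt0.
  by rewrite ltrD2l gtrN.
by rewrite mulr_gt0// exprn_gt0.
Qed.

Context (d : measure_display) (T : measurableType d) (P : probability T R).
Context (n m : nat) (G : 'I_n -> 'I_m -> {RV P >-> R}).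
Hypothesis gaussG : gaussian_matrix G.

Lemma gaussian_entry i j (B : set R) :
  measurable B -> P (G i j @^-1` B) = normal_prob 0 1 B.
Proof. by move=> mB; case: gaussG => /(_ i j B mB) <-. Qed.

Definition column_hits (k : 'I_n) (j : 'I_m) : set T :=
  [set t | hits delta (fun i => G i j t) k].

Let column_hitsE k (S : {set 'I_m}) :
  \bigcap_(j in [set` S]) column_hits k j =
  \bigcap_(x in [set` finset (fun x : 'I_n * 'I_m => x.2 \in S)])
    (G x.1 x.2 @^-1` box (x.1 == k)).
Proof.
have hitP j t : column_hits k j t <-> forall i, box (i == k) (G i j t).
  split=> [/forallP h i|h]; last apply/forallP => i.
    by have := h i; rewrite /box/= in_itv/= ler_distl.
  by have := h i; rewrite /box/= in_itv/= ler_distl.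
apply/seteqP; split => t h.
  by move=> [i j]; rewrite /= inE/= => jS; have /hitP := h j jS; apply.
move=> j /= jS; apply/hitP => i.
by apply: (h (i, j)); rewrite /= inE.
Qed.

Lemma measurable_column_hits k j : measurable (column_hits k j).
Proof.
rewrite (_ : column_hits k j = \bigcap_(j in [set` [set j]%SET]) column_hits k j).
  rewrite column_hitsE; apply: fin_bigcap_measurable; first exact: finite_finset.
  move=> x _; rewrite -[X in measurable X]setTI.
  by apply: measurable_funP => //; exact: measurable_itv.
apply/seteqP; split => [t h j'/=|t]; first by rewrite inE => /eqP ->.
by apply; rewrite /= inE.
Qed.

(** All entries of the columns in [S] lie in prescribed intervals, so entrywise
    independence applies; singletons and pairs [S] give the marginals and the
    pairwise independence of the hitting events. *)
Lemma column_hits_joint k (S : {set 'I_m}) :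
  P (\bigcap_(j in [set` S]) column_hits k j) = (hit_prob n ^+ #|S|)%:E.
Proof.
rewrite column_hitsE; case: gaussG => _ /(_ _ (fun x => box (x.1 == k))) ->; last first.
  by move=> x; exact: measurable_itv.
rewrite (eq_bigr (fun x => (box_prob (x.1 == k))%:E)); last first.
  by move=> x _; rewrite gaussian_entry ?box_probE//; exact: measurable_itv.
have -> : hit_prob n = \prod_i box_prob (i == k).
  rewrite (bigD1 k)//= eqxx; congr (_ * _).
  rewrite (eq_bigr (fun=> box_prob false)); last by move=> i /negbTE ->.
  by rewrite prodr_const cardC1 card_ord.
rewrite -prodrXl -(big_morph EFin EFinM (erefl _)).
congr EFin; under [RHS]eq_bigr do rewrite -prodr_const.
by rewrite pair_big/=; apply: eq_bigl => x; rewrite inE.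
Qed.

Lemma column_hits_prob k j : P (column_hits k j) = (hit_prob n)%:E.
Proof.
rewrite -[hit_prob n]expr1 -(cards1 j) -(column_hits_joint k); congr (P _).
apply/seteqP; split => [t h j'/=|t]; first by rewrite inE => /eqP ->.
by apply; rewrite /= inE.
Qed.

Lemma column_hits_pair k j j' : j != j' ->
  P (column_hits k j `&` column_hits k j') = (hit_prob n * hit_prob n)%:E.
Proof.
move=> jj'; rewrite -expr2.
have -> : 2%N = #|[set j; j']%SET| by rewrite cards2 jj'.
rewrite -(column_hits_joint k); congr (P _).
apply/seteqP; split => [t [h h'] i/=|t h].
  by rewrite !inE => /orP[] /eqP ->.
by split; apply: h; rewrite /= !inE eqxx ?orbT.
Qed.

End GaussianColumns.

(** The exceptional event is the union of [n] events of a large entry in the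
    first column and [n] events of a rarely hit basis vector, each of probability
    at most [e = eps / (2 (n + 1))].  Neither the constant [C] nor [M0] depends on
    the probability space. *)
Lemma gaussian_good_event (R : realType) (n : nat) (delta eps : R) :
  0 < delta -> 0 < eps ->
  exists2 C : R, 0 <= C & exists M0 : nat, forall M, (M0 <= M)%N -> (0 < M)%N ->
    forall (d : measure_display) (T : measurableType d) (P : probability T R)
      (G : 'I_n -> 'I_M.+1 -> {RV P >-> R}), gaussian_matrix G ->
    exists2 good : set T, measurable good /\ ((1 - eps)%:E <= P good)%E &
      forall t, good t -> (forall i, `|G i ord0 t| <= C) /\
        forall k, hit_prob delta n * M%:R / 2 <=
          #|[pred j | hits delta (fun i => G i (lift ord0 j) t) k]|%:R.
Proof.
move=> delta0 eps0.
pose e := eps / (2 * n.+1%:R).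
have e0 : 0 < e by rewrite divr_gt0// mulr_gt0.
have [C C0 PC] := probability_tight (normal_prob (0 : R) 1) e0.
pose q := hit_prob delta n; have q0 : 0 < q by exact: hit_prob_gt0.
exists C => //; exists (Num.bound (4 / (q * e))) => M M0M M_gt0 d T P G gaussG.
have MR : 0 < M%:R :> R by rewrite ltr0n.
pose large i : set T := [set t | C < `|G i ord0 t|].
pose hit k (j : 'I_M) : set T := column_hits delta G k (lift ord0 j).
pose rare k : set T := [set t | #|[pred j | t \in hit k j]|%:R < q * #|'I_M|%:R / 2].
have mabs : measurable [set x : R | C < `|x|].
  rewrite [X in measurable X](_ : _ = (@Num.norm R R) @^-1` `]C, +oo[).
    by rewrite -[X in measurable X]setTI; exact: normr_measurable.
  by apply/seteqP; split => x; rewrite /= in_itv/= andbT.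
have mlarge i : measurable (large i).
  rewrite -[X in measurable X]setTI.
  by rewrite (_ : large i = G i ord0 @^-1` [set x | C < `|x|])//; apply: measurable_funP.
have Plarge i : (P (large i) <= e%:E)%E.
  by rewrite -[large i]/(G i ord0 @^-1` [set x | C < `|x|]) (gaussian_entry gaussG).
have hit_count k : measurable (rare k) /\ (P (rare k) <= (4 / (q * #|'I_M|%:R))%:E)%E.
  apply: pairwise_independent_count => // [j|j|i j ij].
  - exact: measurable_column_hits.
  - exact: column_hits_prob.
  - by apply: column_hits_pair => //; rewrite (inj_eq lift_inj).
have mrare k : measurable (rare k) by case: (hit_count k).
have Prare k : (P (rare k) <= e%:E)%E.
  case: (hit_count k) => _ /le_trans; apply; rewrite lee_fin card_ord.
  have qe0 : 0 < q * e by exact: mulr_gt0.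
  have : 4 / (q * e) <= M%:R.
    have ratio0 : 0 <= 4 / (q * e) by rewrite divr_ge0// ltW.
    have /ltW/le_trans := archi_boundP ratio0; apply.
    by rewrite ler_nat.
  have qM0 : 0 < q * M%:R by exact: mulr_gt0.
  rewrite (ler_pdivrMr _ _ qe0) (ler_pdivrMr _ _ qM0) => /le_trans; apply.
  by rewrite [leRHS](_ : _ = M%:R * (q * e))//; ring.
pose bad := \big[setU/set0]_i large i `|` \big[setU/set0]_k rare k.
have mL : measurable (\big[setU/set0]_i large i) by exact: bigsetU_measurable.
have mRare : measurable (\big[setU/set0]_k rare k) by exact: bigsetU_measurable.
have mbad : measurable bad by exact: measurableU.
exists (~` bad).
  split; first exact: measurableC.
  rewrite probability_setC// EFinB leeB//.
  have bound (F : 'I_n -> set T) : (forall i, measurable (F i)) ->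
      (forall i, (P (F i) <= e%:E)%E) ->
      (P (\big[setU/set0]_i F i) <= (n%:R * e)%:E)%E.
    move=> mF PF; apply: le_trans (probability_bigsetU_le P mF) _.
    apply: (@le_trans _ _ (\sum_(i < n) e%:E)%E); first exact: lee_sum.
    by rewrite sumEFin sumr_const card_ord mulr_natl.
  apply: le_trans (measureU2 P mL mRare) _.
  apply: le_trans (leeD (bound _ mlarge Plarge) (bound _ mrare Prare)) _.
  rewrite -EFinD lee_fin.
  have -> : eps = n.+1%:R * e + n.+1%:R * e.
    have : n.+1%:R != 0 :> R by rewrite pnatr_eq0.
    by rewrite /e; set N := n.+1%:R => N_neq0; field.
  by rewrite lerD// ler_pM2r// ler_nat.
move=> t nbad; split=> [i|k].
  rewrite leNgt; apply/negP => Clt; apply: nbad; left.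
  by rewrite -bigcup_seq; exists i => //=; rewrite mem_index_enum.
have -> : #|[pred j | hits delta (fun i => G i (lift ord0 j) t) k]| =
    #|[pred j | t \in hit k j]|.
  by apply: eq_card => j; rewrite !inE; apply/idP/idP; rewrite inE.
rewrite leNgt; apply/negP => few; apply: nbad; right.
rewrite -bigcup_seq; exists k; first by rewrite /= mem_index_enum.
by rewrite /rare/= card_ord.
Qed.

(** * Large radius on the Gaussian kernel *)

Theorem proposition3p11 (R : realType) (p pstar lambda : R)
    (hp : 1 < p <= 2) (hpstar : p^-1 + pstar^-1 = 1)
    (hlambda : 0 < lambda < pstar^-1)
    (eps : R) (heps : 0 < eps < 1) (n : nat) :
  exists m0 : nat, (n < m0)%N /\
    forall m : nat, (m0 <= m)%N ->
    forall (d : measure_display) (T : measurableType d) (P : probability T R)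
      (G : 'I_n -> 'I_m -> {RV P >-> R}), gaussian_matrix G ->
    let sigma := fun j : nat => (j%:R : R) `^ (- lambda) in
    let event :=
      [set t : T | (2^-1%:E <= euclidean_rad (ellipsoid p sigma) (E_ran G t))%E] in
    measurable event /\ ((1 - eps)%:E <= P event)%E.
Proof.
have [p_gt1 _] := andP hp; have [eps_gt0 _] := andP heps.
have [lambda_gt0 lambda_lt] := andP hlambda.
have p_gt0 : 0 < p by exact: lt_trans p_gt1.
have exponent : lambda * p + 1 < p.
  have : lambda * p < (1 - p^-1) * p by rewrite ltr_pM2r// -hpstar addrC addKr.
  by rewrite mulrBl mul1r mulVf ?gt_eqF// ltrBrDr.
pose delta : R := (2 * n.+1%:R)^-1.
have delta_gt0 : 0 < delta by rewrite invr_gt0 mulr_gt0.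
have n_delta : n%:R * delta <= 2^-1.
  rewrite /delta invfM mulrCA ler_piMr// ler_pdivrMr// mul1r ler_nat//.
have [C C_ge0 [M1 goodP]] := gaussian_good_event n delta_gt0 eps_gt0.
pose q : R := hit_prob delta n; have q_gt0 : 0 < q by exact: hit_prob_gt0.
(* [D / M] is the bound on the entries of the correction when every basis
   vector is hit by [q M / 2] columns. *)
pose D : R := 2 * (n%:R * C) / (q / 2).
have D_ge0 : 0 <= D.
  by apply: divr_ge0; [rewrite !mulr_ge0 ?ler0n|apply: ltW; exact: divr_gt0].
have [M0 weightedP] :=
  spread_weighted_sum_le1 (ltW p_gt0) (ltW lambda_gt0) exponent D_ge0.
exists (maxn n (maxn M0 M1)).+2; split; first by rewrite ltnS leqW// leq_maxl.
move=> [//|M]; rewrite ltnS => m0M d T P G gaussG sigma event.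
have M_gt0 : (0 < M)%N by exact: leq_ltn_trans m0M.
have M0M : (M0 <= M)%N by rewrite (leq_trans _ (ltnW m0M))// !leq_max leqnn orbT.
have M1M : (M1 <= M)%N by rewrite (leq_trans _ (ltnW m0M))// !leq_max leqnn !orbT.
have mevent : measurable event.
  by apply: measurable_rad_ge => // i; rewrite powR_gt0.
split => //.
have [good [mgood Pgood] goodt] := goodP _ M1M M_gt0 _ _ _ _ gaussG.
apply: le_trans Pgood _; apply: le_measure; rewrite ?inE// => t /goodt[small many].
have M_pos : 0 < M%:R :> R by rewrite ltr0n.
have s_gt0 : 0 < q * M%:R / 2 by apply: divr_gt0 => //; exact: mulr_gt0.
have rhs_le i : `|- G i ord0 t| <= C by rewrite normrN.
have [y yeq ysmall] := spread_solution
  (A := fun i j => G i (lift ord0 j) t) n_delta s_gt0 rhs_le many.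
apply: (kernel_vector (sigma := sigma) (ltW p_gt1) _ yeq); first by rewrite /sigma powR1.
apply: (weightedP M M0M M_gt0) => j; apply: le_trans (ysmall j) _.
rewrite le_eqVlt; apply/orP; left; apply/eqP.
by rewrite /D; field; rewrite (gt_eqF M_pos) (gt_eqF q_gt0).
Qed.
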